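(* Let $p$ be a prime, $K=\mathbb{F}_{p^r}$ and $\sigma(x)=x^{p^s}$ with $s\mid r$, so that $\sigma$ has order $m=r/s$ and fixed field $K_0=\mathbb{F}_{p^s}$. Let $n\ge2$ and write $[i]_s=\frac{p^{si}-1}{p^s-1}$. The number of distinct $(n,\sigma)$-isometry classes of families of skew $(\sigma,a)$-constacyclic codes of length $n$ ($a\in K^\times$) arising from nonassociative rings $\mathbb{K}_{t^n-a}$ is $N$, where $$N=\begin{cases}\gcd([n]_s,p^r-1)&\text{if } m\nmid n,\\ \left(1-\frac{1}{[m]_s}\right)\gcd([n]_s,p^r-1)&\text{if } m\mid n.\end{cases}$$ There are additionally $\gcd([n]_s,p^r-1)/[m]_s$ different $(n,\sigma)$-equivalence classes (and thus at most this many $(n,\sigma)$-isometry classes) of families of skew $(\sigma,a)$-constacyclic codes arising from associative rings $\mathbb{K}_{t^n-a}$, that is, for which $m\mid n$ and $a\in K_0$.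
   Context: $K[t;\sigma]$ is the skew polynomial ring with $tc=\sigma(c)t$ for $c\in K$. For a monic $f\in K[t;\sigma]$ of degree $n$, every $g$ can be written uniquely as $g=qf+r$ with $\deg r<n$; write $r=g\bmod_r f$. The Petit ring $\mathbb{K}_f$ is the additive group of skew polynomials of degree $<n$ with multiplication $g\circ h=gh\bmod_r f$; it is a unital, in general nonassociative, ring containing $K$. A skew $(\sigma,a)$-constacyclic code of length $n$ is a linear code $C\subset K^n$ such that $(c_0,\dots,c_{n-1})\in C$ implies $(\sigma(c_{n-1})a,\sigma(c_0),\dots,\sigma(c_{n-2}))\in C$; the family of all these codes (for fixed $a$) is attached to the ring $\mathbb{K}_{t^n-a}$. For $a,b\in K^\times$, the families attached to $a$ and $b$ (equivalently the rings $\mathbb{K}_{t^n-a}$, $\mathbb{K}_{t^n-b}$) are $(n,\sigma)$-equivalent if there is a ring isomorphism $\mathbb{K}_{t^n-a}\to\mathbb{K}_{t^n-b}$ that is the identity on $K$ and sends $t\mapsto\alpha t$ for some $\alpha\in K^\times$; they are $(n,\sigma)$-isometric if there is a ring isomorphism that is the identity on $K$ and sends $t\mapsto\alpha t^k$ for some $\alpha\in K^\times$ and $1\le k<n$. So the count is of classes of parameters $a\in K^\times$ under these relations, restricted to those $a$ for which $\mathbb{K}_{t^n-a}$ is nonassociative (respectively associative). *)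

(* Defs.v *)
From HB Require Import structures.
From mathcomp Require Import all_boot all_order all_algebra.
From mathcomp Require Import boolp.

Set Implicit Arguments.
Unset Strict Implicit.
Unset Printing Implicit Defensive.

Import GRing.Theory.
Local Open Scope ring_scope.

(* K[t; sigma] has the same underlying additive group as K[X], with the
   coefficients written on the left; only the product is changed. *)
Definition skew_poly (K : fieldType) (sigma : {rmorphism K -> K}) : Type :=
  {poly K}.

HB.instance Definition _ (K : fieldType) (sigma : {rmorphism K -> K}) :=
  GRing.Zmodule.on (skew_poly sigma).

Section SkewPoly.
Variables (K : fieldType) (sigma : {rmorphism K -> K}).
Implicit Types g h : {poly K}.

(* (c t^i) h = \sum_j c sigma^i(h_j) t^(i + j) *)
Definition skew_mul g h : {poly K} :=
  \sum_(i < size g) g`_i *: (map_poly (iter i sigma) h * 'X^i).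

Lemma iter_sigma0 i : iter i sigma 0 = 0.
Proof. by elim: i => //= i ->; rewrite rmorph0. Qed.

Lemma iter_sigma1 i : iter i sigma 1 = 1.
Proof. by elim: i => //= i ->; rewrite rmorph1. Qed.

Lemma iter_sigmaD i : {morph iter i sigma : x y / x + y}.
Proof. by move=> x y; elim: i => //= i ->; rewrite rmorphD. Qed.

Lemma iter_sigmaM i : {morph iter i sigma : x y / x * y}.
Proof. by move=> x y; elim: i => //= i ->; rewrite rmorphM. Qed.

Lemma coef_map_iter i h j : (map_poly (iter i sigma) h)`_j = iter i sigma h`_j.
Proof. by rewrite coef_map_id0 // iter_sigma0. Qed.

Lemma skew_mul_wide m g h : (size g <= m)%N ->
  skew_mul g h = \sum_(i < m) g`_i *: (map_poly (iter i sigma) h * 'X^i).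
Proof.
move=> le_gm; rewrite /skew_mul.
rewrite (big_ord_widen m
  (fun i => g`_i *: (map_poly (iter i sigma) h * 'X^i))) // big_mkcond /=.
apply: eq_bigr => i _; case: ifP => // /negbT; rewrite -leqNgt => le_gi.
by rewrite nth_default // scale0r.
Qed.

Lemma skew_mulDl : left_distributive skew_mul +%R.
Proof.
move=> g1 g2 h; set m := maxn (size g1) (size g2).
rewrite (@skew_mul_wide m (g1 + g2)) ?size_polyD //.
rewrite (@skew_mul_wide m g1) ?leq_maxl // (@skew_mul_wide m g2) ?leq_maxr //.
by rewrite -big_split; apply: eq_bigr => i _; rewrite coefD scalerDl.
Qed.

Lemma skew_mulDr : right_distributive skew_mul +%R.
Proof.
move=> g h1 h2; rewrite /skew_mul -big_split; apply: eq_bigr => i _ /=.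
rewrite -scalerDr -mulrDl; congr (_ *: (_ * _)); apply/polyP => j.
by rewrite coefD !coef_map_iter coefD iter_sigmaD.
Qed.

Lemma skew_mul0l h : skew_mul 0 h = 0.
Proof. by rewrite /skew_mul size_poly0 big_ord0. Qed.

Lemma skew_mul_suml (I : Type) (s : seq I) (P : pred I) (F : I -> {poly K}) h :
  skew_mul (\sum_(i <- s | P i) F i) h = \sum_(i <- s | P i) skew_mul (F i) h.
Proof.
by apply: (big_morph (skew_mul^~ h)); [move=> x y; exact: skew_mulDl
  | exact: skew_mul0l].
Qed.

Lemma skew_mul_monol c i h :
  skew_mul (c *: 'X^i) h = c *: (map_poly (iter i sigma) h * 'X^i).
Proof.
rewrite (@skew_mul_wide i.+1); last first.
  by rewrite (leq_trans (size_scale_leq _ _)) ?size_polyXn.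
rewrite big_ord_recr /= big1 => [|j _]; last first.
  by rewrite coefZ coefXn (ltn_eqF (ltn_ord j)) mulr0 scale0r.
by rewrite add0r coefZ coefXn eqxx mulr1.
Qed.

Lemma skew_mul_monoM c i g h :
  skew_mul (c *: (map_poly (iter i sigma) g * 'X^i)) h
    = c *: (map_poly (iter i sigma) (skew_mul g h) * 'X^i).
Proof.
have -> : map_poly (iter i sigma) g =
    \sum_(j < size g) iter i sigma g`_j *: 'X^j.
  apply/polyP => k; rewrite coef_map_iter coef_sum.
  have [lt_kg|le_gk] := ltnP k (size g).
    rewrite (bigD1 (Ordinal lt_kg)) //= coefZ coefXn eqxx mulr1 big1 ?addr0 //.
    by move=> j /negPf nejk; rewrite coefZ coefXn eq_sym (_ : _ == _ = false) ?mulr0.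
  rewrite nth_default // iter_sigma0 big1 // => j _.
  rewrite coefZ coefXn (_ : _ == _ = false) ?mulr0 //.
  by rewrite gtn_eqF // (leq_trans (ltn_ord j)).
rewrite mulr_suml scaler_sumr skew_mul_suml.
have -> : map_poly (iter i sigma) (skew_mul g h) =
   \sum_(j < size g) map_poly (iter i sigma)
      (g`_j *: (map_poly (iter j sigma) h * 'X^j)).
  apply/polyP => k; rewrite coef_map_iter /skew_mul !coef_sum.
  rewrite (big_morph _ (iter_sigmaD i) (iter_sigma0 i)).
  by apply: eq_bigr => j _; rewrite coef_map_iter.
rewrite mulr_suml scaler_sumr; apply: eq_bigr => j _.
rewrite -scalerAl -exprD scalerA skew_mul_monol -scalerA; congr (_ *: _).
apply/polyP => k; rewrite coefZ !coefMXn addnC.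
have [lt_ki|le_ik] := ltnP k i.
  by rewrite (leq_trans lt_ki (leq_addr _ _)) mulr0.
rewrite [RHS]coef_map_iter coefZ iter_sigmaM coefMXn ltn_subLR // subnDA.
case: ifP => _; first by rewrite iter_sigma0.
by rewrite !coef_map_iter iterD.
Qed.

Lemma skew_mulA : associative skew_mul.
Proof.
move=> f g h; rewrite {2}/skew_mul skew_mul_suml {1}/skew_mul.
by apply: eq_bigr => i _; rewrite skew_mul_monoM.
Qed.

Lemma skew_mul1l : left_id 1 skew_mul.
Proof.
move=> h; have -> : 1 = 1 *: 'X^0 :> {poly K} by rewrite expr0 scale1r.
rewrite skew_mul_monol expr0 mulr1 scale1r.
by apply/polyP => k; rewrite coef_map_iter.
Qed.

Lemma skew_mul1r : right_id 1 skew_mul.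
Proof.
move=> g; rewrite /skew_mul -[RHS]coefK poly_def.
apply: eq_bigr => i _; congr (_ *: _); rewrite -[RHS]mul1r; congr (_ * _).
apply/polyP => k; rewrite coef_map_iter coef1.
by case: (k == _); rewrite ?iter_sigma1 ?iter_sigma0.
Qed.

End SkewPoly.

HB.instance Definition _ (K : fieldType) (sigma : {rmorphism K -> K}) :=
  GRing.Zmodule_isNzRing.Build (skew_poly sigma)
    (@skew_mulA K sigma) (@skew_mul1l K sigma) (@skew_mul1r K sigma)
    (@skew_mulDl K sigma) (@skew_mulDr K sigma) (oner_neq0 {poly K}).

Section Petit.
Variables (K : fieldType) (sigma : {rmorphism K -> K}).
Local Notation Kt := (skew_poly sigma).
Local Notation P g := ((g : Kt) : {poly K}).

Definition skewC (c : K) : Kt := c%:P.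
Definition skewX : Kt := 'X.

Definition skew_size (g : Kt) : nat := size (P g).
Definition skew_lead (g : Kt) : K := lead_coef (P g).
Definition skew_monic (g : Kt) : bool := skew_lead g == 1.

Lemma skewXC c : skewX * skewC c = skewC (sigma c) * skewX.
Proof.
rewrite /skewX /skewC [LHS](_ : _ = skew_mul sigma 'X c%:P) //.
rewrite [RHS](_ : _ = skew_mul sigma (sigma c)%:P 'X) //.
have {1}-> : 'X = 1 *: 'X^1 :> {poly K} by rewrite scale1r.
have -> : (sigma c)%:P = sigma c *: 'X^0 by rewrite -mul_polyC mulr1.
rewrite !skew_mul_monol scale1r expr0 expr1 mulr1 -mul_polyC.
have -> : map_poly (iter 0 sigma) 'X = 'X.
  by apply/polyP => k; rewrite coef_map_iter.
have -> // : map_poly (iter 1 sigma) c%:P = (sigma c)%:P.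
apply/polyP => k; rewrite coef_map_iter !coefC /=.
by case: eqP => // _; rewrite rmorph0.
Qed.


Lemma skewXn n : P (skewX ^+ n) = 'X^n.
Proof.
elim: n => // n IHn; rewrite exprS.
have -> : P (skewX * skewX ^+ n) = skew_mul sigma 'X (P (skewX ^+ n)) by [].
rewrite IHn -[X in skew_mul _ X _]scale1r -['X in LHS]expr1 skew_mul_monol.
rewrite scale1r expr1 exprSr; congr (_ * _); apply/polyP => k.
by rewrite coef_map_iter coefXn /=; case: (k == n); rewrite ?rmorph1 ?rmorph0.
Qed.

(* For monic f, subtracting lead(r) t^(deg r - deg f) f from r removes the
   leading term of r; the leading coefficient of that left multiple of f is
   lead(r) sigma^(deg r - deg f)(1) = lead(r). *)
Fixpoint skew_rmod_rec (f r : Kt) (k : nat) : Kt :=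
  if k is k'.+1 then
    if (skew_size r < skew_size f)%N then r
    else skew_rmod_rec f
      (r - skewC (skew_lead r) * skewX ^+ (skew_size r - skew_size f) * f) k'
  else r.

Definition skew_rmod (g f : Kt) : Kt := skew_rmod_rec f g (skew_size g).

Lemma skew_monomM c i (f : Kt) :
  P (skewC c * skewX ^+ i * f) =
    c *: (map_poly (iter i sigma) (P f) * 'X^i).
Proof.
have Ec : P (skewC c * skewX ^+ i) = c *: 'X^i.
  have -> : P (skewC c * skewX ^+ i) =
      skew_mul sigma (c *: 'X^0) (P (skewX ^+ i))
    by rewrite expr0 -mul_polyC mulr1.
  rewrite skew_mul_monol skewXn expr0 mulr1; congr (_ *: _).
  by apply/polyP => k; rewrite coef_map_iter.
have -> : P (skewC c * skewX ^+ i * f) =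
    skew_mul sigma (P (skewC c * skewX ^+ i)) (P f) by [].
by rewrite Ec skew_mul_monol.
Qed.

Lemma size_map_iter i (h : {poly K}) :
  size (map_poly (iter i sigma) h) = size h.
Proof.
apply: size_map_inj_poly; last exact: iter_sigma0.
elim: i => //= i IHi x y /= /fmorph_inj; exact: IHi.
Qed.

Lemma skew_size_monicM (f g : Kt) :
  skew_monic f -> g != 0 -> (skew_size f <= skew_size (g * f)%R)%N.
Proof.
move=> /eqP mf nz_g.
have f0 : (0 < size (P f))%N.
  rewrite lt0n size_poly_eq0; apply/eqP => fE.
  by move/eqP: mf; rewrite /skew_lead fE lead_coef0 eq_sym oner_eq0.
have g0 : (0 < size (P g))%N by rewrite lt0n size_poly_eq0.
rewrite leqNgt; apply/negP => lt_gf.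
have lead0 : lead_coef (P g) != 0 by rewrite lead_coef_eq0.
have: (P (g * f))`_((size (P g)).-1 + (size (P f)).-1)
   = 0.
  apply: nth_default; rewrite -ltnS (leq_trans lt_gf) //.
  by rewrite /skew_size -[X in (X <= _)%N](prednK f0) ltnS leq_addl.
have -> : (P (g * f)) = skew_mul sigma g f by [].
rewrite /skew_mul coef_sum.
have lt_last : ((size (P g)).-1 < size (P g))%N
  by rewrite prednK.
rewrite (bigD1 (Ordinal lt_last)) //= big1 ?addr0 => [|i ne_i]; last first.
  rewrite coefZ coefMXn; case: ifP => _; first by rewrite mulr0.
  rewrite coef_map_iter [X in iter _ _ X]nth_default ?iter_sigma0 ?mulr0 //.
  have lt_i : (i < (size (P g)).-1)%N.
    rewrite ltn_neqAle -ltnS prednK // ltn_ord andbT.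
    by apply: contra ne_i => /eqP Ei; apply/eqP/val_inj.
  by rewrite -addnBAC ?(ltnW lt_i) // -{1}(prednK f0) -add1n leq_add2r subn_gt0.
rewrite coefZ coefMXn ltnNge leq_addr /= addKn coef_map_iter.
move: mf; rewrite /skew_lead lead_coefE => ->.
rewrite iter_sigma1 mulr1 => /eqP.
by rewrite -lead_coefE (negPf lead0).
Qed.

(* Right division by a monic f: skew_rmod g f is the unique remainder. *)
Lemma skew_rmodP (f g : Kt) : skew_monic f ->
  (exists q : Kt, g = q * f + skew_rmod g f) /\
  (skew_size (skew_rmod g f) < skew_size f)%N.
Proof.
move=> mf; rewrite /skew_rmod.
have f0 : (0 < skew_size f)%N.
  rewrite lt0n /skew_size size_poly_eq0; apply/eqP => fE.
  by move: mf; rewrite /skew_monic /skew_lead fE lead_coef0 eq_sym oner_eq0.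
have: (skew_size g <= skew_size g)%N by [].
move: {2 3 4}(skew_size g) => k.
elim: k g => [|k IHk] g le_gk /=.
  split; first by exists 0; rewrite mul0r add0r.
  by rewrite (leq_ltn_trans le_gk).
case: ltnP => [lt_gf|le_fg]; first by split=> //; exists 0; rewrite mul0r add0r.
set u := skewC _ * _; case: (IHk (g - u * f)) => [|[q Eq] lt_rf]; last first.
  split=> //; exists (q + u); rewrite mulrDl addrAC -Eq.
  by rewrite subrK.
rewrite -ltnS (leq_trans _ le_gk) // -[skew_size g]prednK ?(leq_trans f0) // ltnS.
apply/leq_sizeP => j le_j.
have -> : (P (g - u * f))`_j
     = (P g)`_j - (P (u * f))`_j by rewrite coefB.
rewrite /u skew_monomM coefZ coefMXn coef_map_iter.
have le_dj : (skew_size g - skew_size f <= j)%N.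
  by rewrite (leq_trans _ le_j) // -subn1 leq_sub2l.
rewrite ltnNge le_dj /=.
have [Ej|ne_j] := eqVneq j (skew_size g).-1.
  have -> : (j - (skew_size g - skew_size f) = (skew_size f).-1)%N.
    by rewrite Ej -!subn1 subnAC subKn.
  move/eqP: mf; rewrite /skew_lead lead_coefE => ->.
  by rewrite iter_sigma1 mulr1 Ej lead_coefE subrr.
have lt_j : (skew_size g <= j)%N.
  rewrite -[skew_size g]prednK ?(leq_trans f0) // ltn_neqAle le_j.
  by rewrite eq_sym ne_j.
rewrite !nth_default ?iter_sigma0 ?mulr0 ?subr0 //.
by rewrite leq_subRL ?subnK // (leq_trans (leq_subr _ _)).
Qed.

Lemma skew_rmod_uniq (f g q r : Kt) : skew_monic f ->
  g = q * f + r -> (skew_size r < skew_size f)%N -> r = skew_rmod g f.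
Proof.
move=> mf Eg lt_rf; have [[q' Eg'] lt_rf'] := skew_rmodP g mf.
have E : (q - q') * f = skew_rmod g f - r.
  rewrite mulrBl; apply/eqP; rewrite subr_eq addrAC eq_sym subr_eq.
  by rewrite addrC -Eg' Eg.
have [Eq|ne_q] := eqVneq (q - q') 0.
  by move/esym/eqP: E; rewrite Eq mul0r subr_eq0 => /eqP.
have := skew_size_monicM mf ne_q; rewrite E leqNgt => /negP[].
apply: leq_ltn_trans (_ : _ <= maxn (skew_size (skew_rmod g f)) (skew_size r))%N _.
  by rewrite /skew_size -(size_polyN (P r)) size_polyD.
by rewrite gtn_max lt_rf' lt_rf.
Qed.

(* Skew polynomials of degree < deg f; note that deg f = (size f).-1. *)
Definition petit_pred (f : Kt) : {pred Kt} :=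
  fun g => (skew_size g <= (skew_size f).-1)%N.

Lemma petit_zmod_closed f : zmod_closed (petit_pred f).
Proof.
split=> [|g h]; rewrite !unfold_in /skew_size ?size_poly0 // => le_g le_h.
apply: leq_trans (_ : _ <= maxn (size (P g)) (size (P h)))%N _.
  by rewrite -(size_polyN (P h)) size_polyD.
by rewrite geq_max le_g.
Qed.

HB.instance Definition _ f :=
  GRing.isZmodClosed.Build Kt (petit_pred f) (petit_zmod_closed f).

Record petit (f : Kt) : Type :=
  Petit { petit_val :> Kt; _ : petit_val \in petit_pred f }.

HB.instance Definition _ f := [isSub for @petit_val f].
HB.instance Definition _ f := [Choice of petit f by <:].
HB.instance Definition _ f := [SubChoice_isSubZmodule of petit f by <:].

(* The element g mod_r f of the Petit ring of a monic f. *)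
Definition petit_of (f g : Kt) : petit f := insubd (0 : petit f) (skew_rmod g f).

Lemma petit_ofE f g : skew_monic f -> petit_of f g = skew_rmod g f :> Kt.
Proof.
move=> mf; apply: (insubdK (0 : petit f)).
have [_ lt_rf] := skew_rmodP g mf.
rewrite -[_ \in _]/(skew_size _ <= _)%N -ltnS prednK //.
exact: leq_ltn_trans (leq0n _) lt_rf.
Qed.

Definition petit_mul (f : Kt) (g h : petit f) : petit f :=
  petit_of f ((g : Kt) * (h : Kt)).

Definition petit_one (f : Kt) : petit f := petit_of f 1.

Definition petit_iso (f1 f2 : Kt) (G : petit f1 -> petit f2) : Prop :=
  [/\ bijective G, {morph G : x y / x + y},
      {morph G : x y / petit_mul x y}
    & G (petit_one f1) = petit_one f2].

Definition constacyclic_poly (n : nat) (a : K) : Kt := skewX ^+ n - skewC a.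

Lemma constacyclic_polyE n a : constacyclic_poly n a = 'X^n - a%:P :> {poly K}.
Proof. by rewrite -skewXn. Qed.

Lemma constacyclic_poly_size n a :
  (0 < n)%N -> skew_size (constacyclic_poly n a) = n.+1.
Proof. by move=> n_gt0; rewrite /skew_size constacyclic_polyE size_XnsubC. Qed.

Lemma constacyclic_poly_monic n a :
  (0 < n)%N -> skew_monic (constacyclic_poly n a).
Proof.
move=> n_gt0; rewrite /skew_monic /skew_lead constacyclic_polyE.
by rewrite lead_coefXnsubC.
Qed.

(* There is a ring isomorphism K_{t^n-a} -> K_{t^n-b} that is the identity on K
   and sends t to alpha t^k. *)
Definition monomial_iso (n : nat) (a b alpha : K) (k : nat) : Prop :=
  let fa := constacyclic_poly n a in
  let fb := constacyclic_poly n b in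
  exists G : petit fa -> petit fb,
    [/\ petit_iso G,
        forall c : K, G (petit_of fa (skewC c)) = petit_of fb (skewC c)
      & G (petit_of fa skewX) = petit_of fb (skewC alpha * skewX ^+ k)].

Definition nsigma_equivalent (n : nat) (a b : K) : Prop :=
  exists alpha : K, alpha != 0 /\ monomial_iso n a b alpha 1.

Definition nsigma_isometric (n : nat) (a b : K) : Prop :=
  exists (alpha : K) (k : nat),
    [/\ alpha != 0, (1 <= k < n)%N & monomial_iso n a b alpha k].

Definition petit_associative (n : nat) (a : K) : Prop :=
  associative (@petit_mul (constacyclic_poly n a)).

End Petit.

Section Classes.
Variables (K : finFieldType) (sigma : {rmorphism K -> K}).

Definition fixed_field : {set K} := [set x | sigma x == x].

(* The family of skew (sigma, a)-constacyclic codes of length n is represented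
   by its parameter a, so classes of families are classes of nonzero a. *)
Definition assoc_params (n : nat) : {set K} :=
  [set a : K | (a != 0) && `[< petit_associative sigma n a >]].

Definition nonassoc_params (n : nat) : {set K} :=
  [set a : K | (a != 0) && ~~ `[< petit_associative sigma n a >]].

Definition isometry_classes (n : nat) (D : {set K}) : {set {set K}} :=
  equivalence_partition (fun a b => `[< nsigma_isometric sigma n a b >]) D.

Definition equivalence_classes (n : nat) (D : {set K}) : {set {set K}} :=
  equivalence_partition (fun a b => `[< nsigma_equivalent sigma n a b >]) D.

End Classes.

(* [i]_s; the division is exact. *)
Definition bracket (p s i : nat) : nat := ((p ^ (s * i) - 1) %/ (p ^ s - 1))%N.

(* Main.v *)
Require Import Defs.
From mathcomp Require Import all_boot all_order all_algebra all_fingroup.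
From mathcomp Require Import cyclic finfield ring boolp.

(** Write N_i(alpha) for the product of the sigma^j(alpha) with j < i.  The maps
    t^i |-> N_i(alpha) t^i are ring endomorphisms of K[t; sigma], and such a map
    sends t^n - a to a left multiple of t^n - b exactly when a = N_n(alpha) b,
    so the equivalence classes are cosets of the group of [n]_s-th powers in the
    cyclic group of units of K.

    Isometries t |-> alpha t^k with k > 1 exist only between associative rings:
    products of powers of t of total degree below n associate in the source,
    but their images wrap around t^n = b, which forces sigma^n = id and
    sigma(b) = b.  Under these two conditions t^n - b is central, so the
    quotient is associative. *)

Set Implicit Arguments.
Unset Strict Implicit.
Unset Printing Implicit Defensive.

Import GRing.Theory Num.Theory.
Local Open Scope ring_scope.

(** * Monomials and the substitutions t |-> alpha t in K[t; sigma] *)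

Section SkewPolynomials.
Variables (K : fieldType) (sigma : {rmorphism K -> K}).
Local Notation Kt := (skew_poly sigma).
Local Notation P g := ((g : Kt) : {poly K}).
Implicit Types (f g h : Kt) (c d : K).

Lemma iter_sigma_eq0 i c : (iter i sigma c == 0) = (c == 0).
Proof. by elim: i => //= i <-; rewrite fmorph_eq0. Qed.

Lemma coef_skew_mul g h k :
  (P (g * h))`_k =
    \sum_(i < size (P g))
      (P g)`_i * (if (k < i)%N then 0 else iter i sigma (P h)`_(k - i)).
Proof.
rewrite [LHS]coef_sum; apply: eq_bigr => i _.
by rewrite coefZ coefMXn coef_map_iter.
Qed.

Lemma skew_monoE c i : P (skewC sigma c * skewX sigma ^+ i) = c *: 'X^i.
Proof.
rewrite -[LHS]/(P (skewC sigma c * skewX sigma ^+ i)) -[_ * _ in LHS]mulr1.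
rewrite skew_monomM; congr (_ *: _).
rewrite -[RHS]mul1r; congr (_ * _); apply/polyP => k.
by rewrite coef_map_iter coef1; case: (k == _); rewrite ?iter_sigma1 ?iter_sigma0.
Qed.

Lemma skew_poly_sum g :
  g = \sum_(i < skew_size g) skewC sigma (P g)`_i * skewX sigma ^+ i.
Proof.
rewrite -[LHS](coefK (P g)) poly_def; apply: eq_bigr => i _.
by rewrite -skew_monoE.
Qed.

Lemma skewCM c d : skewC sigma (c * d) = skewC sigma c * skewC sigma d.
Proof.
have -> : skewC sigma c * skewC sigma d = skew_mul sigma (c *: 'X^0) d%:P.
  by rewrite expr0 alg_polyC.
rewrite skew_mul_monol expr0 mulr1 /skewC polyCM mul_polyC; congr (_ *: _).
by apply/polyP => k; rewrite coef_map_iter.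
Qed.

Lemma skewC1 : skewC sigma 1 = 1.
Proof. by []. Qed.

Lemma skewXnC i c :
  skewX sigma ^+ i * skewC sigma c = skewC sigma (iter i sigma c) * skewX sigma ^+ i.
Proof.
elim: i c => [|i IHi] c; first by rewrite expr0 mul1r mulr1.
by rewrite exprSr -mulrA skewXC mulrA IHi -mulrA -exprSr -iterSr.
Qed.

Lemma skew_monoM c i d j :
  skewC sigma c * skewX sigma ^+ i * (skewC sigma d * skewX sigma ^+ j)
    = skewC sigma (c * iter i sigma d) * skewX sigma ^+ (i + j).
Proof. by rewrite mulrA -(mulrA (skewC _ c)) skewXnC skewCM -!mulrA exprD. Qed.

(** The coefficient in (alpha t)^i = N_i(alpha) t^i; when i is the order of sigma it is the norm to
    the fixed field. *)
Definition twisted_norm (alpha : K) (i : nat) : K :=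
  \prod_(j < i) iter j sigma alpha.

Lemma twisted_norm0 alpha : twisted_norm alpha 0 = 1.
Proof. by rewrite /twisted_norm big_ord0. Qed.

Lemma twisted_normS alpha i :
  twisted_norm alpha i.+1 = twisted_norm alpha i * iter i sigma alpha.
Proof. by rewrite /twisted_norm big_ord_recr. Qed.

(** The cocycle identity read off from (alpha t)^(i+j) = (alpha t)^i (alpha t)^j; it makes
    [skew_scale] multiplicative. *)
Lemma twisted_normD alpha i j :
  twisted_norm alpha (i + j)
    = twisted_norm alpha i * iter i sigma (twisted_norm alpha j).
Proof.
elim: j => [|j IHj]; first by rewrite addn0 twisted_norm0 iter_sigma1 mulr1.
by rewrite addnS !twisted_normS IHj iter_sigmaM -mulrA iterD.
Qed.

Lemma twisted_norm_eq0 alpha i : alpha != 0 -> twisted_norm alpha i != 0.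
Proof. by move=> nz; apply/prodf_neq0 => j _; rewrite iter_sigma_eq0. Qed.

Lemma twisted_normV alpha i :
  twisted_norm alpha^-1 i = (twisted_norm alpha i)^-1.
Proof.
rewrite /twisted_norm -prodfV; apply: eq_bigr => j _.
by elim: (j : nat) => //= k ->; rewrite fmorphV.
Qed.

(** The substitution t |-> alpha t that fixes the coefficients. *)
Definition skew_scale (alpha : K) (g : Kt) : Kt :=
  \poly_(i < size (P g)) (twisted_norm alpha i * (P g)`_i).

Lemma coef_skew_scale alpha g i :
  (P (skew_scale alpha g))`_i = twisted_norm alpha i * (P g)`_i.
Proof.
rewrite coef_poly; case: ltnP => // le_gi.
by rewrite nth_default ?mulr0.
Qed.

Lemma skew_scaleD alpha : {morph skew_scale alpha : g h / g + h}.
Proof.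
move=> g h; apply/polyP => i.
by rewrite coefD !coef_skew_scale coefD mulrDr.
Qed.

Lemma skew_scaleB alpha : {morph skew_scale alpha : g h / g - h}.
Proof.
move=> g h; apply/polyP => i.
by rewrite coefB !coef_skew_scale coefB mulrBr.
Qed.

Lemma skew_scale_size alpha g : (skew_size (skew_scale alpha g) <= skew_size g)%N.
Proof. exact: size_poly. Qed.

Lemma skew_scaleM alpha : {morph skew_scale alpha : g h / g * h}.
Proof.
move=> g h; apply/polyP => k.
have -> : P (skew_scale alpha g * skew_scale alpha h)
   = skew_mul sigma (skew_scale alpha g) (skew_scale alpha h) by [].
(* For alpha = 0 scaling may shorten g, so both sides are summed over the degree range of g
   itself. *)
rewrite (skew_mul_wide _ _ (skew_scale_size alpha g)) coef_sum coef_skew_scale.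
rewrite coef_skew_mul mulr_sumr; apply: eq_bigr => i _.
rewrite coefZ coefMXn coef_map_iter !coef_skew_scale.
case: ltnP => [_|le_ik]; first by rewrite !mulr0.
by rewrite -{1}(subnKC le_ik) twisted_normD iter_sigmaM mulrACA.
Qed.

Lemma skew_scaleK alpha : alpha != 0 ->
  cancel (skew_scale alpha) (skew_scale alpha^-1).
Proof.
move=> nz g; apply/polyP => i; rewrite !coef_skew_scale mulrA twisted_normV.
by rewrite mulVf ?mul1r ?twisted_norm_eq0.
Qed.

Lemma skew_scale_mono alpha c i :
  skew_scale alpha (skewC sigma c * skewX sigma ^+ i)
    = skewC sigma (twisted_norm alpha i * c) * skewX sigma ^+ i.
Proof.
apply/polyP => j; rewrite coef_skew_scale !skew_monoE !coefZ coefXn.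
by case: eqP => [->|]; rewrite ?mulr0 ?mulr1.
Qed.

Lemma skew_scaleC alpha c : skew_scale alpha (skewC sigma c) = skewC sigma c.
Proof.
rewrite -[skewC _ c]mulr1 -[1](expr0 (skewX sigma)) skew_scale_mono.
by rewrite twisted_norm0 mul1r.
Qed.

End SkewPolynomials.

(** * Reduction modulo a monic f *)

Section PetitRing.
Variables (K : fieldType) (sigma : {rmorphism K -> K}) (f : skew_poly sigma).
Hypothesis mf : skew_monic f.
Local Notation Kt := (skew_poly sigma).
Implicit Types (g h q : Kt) (x y z : petit f).

Lemma petit_ofDl g q : petit_of f (g + q * f) = petit_of f g.
Proof.
apply: val_inj; rewrite /= !petit_ofE //; apply/esym.
have [[q' Eg] lt_rf] := skew_rmodP g mf.
apply: (@skew_rmod_uniq _ _ f _ (q' + q)) => //.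
by rewrite {1}Eg mulrDl addrAC.
Qed.

Lemma skew_size_gt0 : (0 < skew_size f)%N.
Proof. by have [_] := skew_rmodP 0 mf; apply: leq_ltn_trans. Qed.

Lemma petit_of_small g :
  (skew_size g < skew_size f)%N -> petit_of f g = g :> Kt.
Proof.
move=> lt_gf; rewrite petit_ofE //; apply/esym.
by apply: (@skew_rmod_uniq _ _ f g 0) => //; rewrite mul0r add0r.
Qed.

Lemma petit_size x : (skew_size x < skew_size f)%N.
Proof. by case: x => g /= lt_g; rewrite -(prednK skew_size_gt0) ltnS. Qed.

Lemma petit_valK x : petit_of f x = x.
Proof. by apply: val_inj; rewrite /= petit_of_small ?petit_size. Qed.

Lemma petit_of_val g : exists q, g = q * f + petit_val (petit_of f g).
Proof. by have [[q Eg] _] := skew_rmodP g mf; exists q; rewrite petit_ofE. Qed.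

Lemma petit_ofD g h : petit_of f (g + h) = petit_of f g + petit_of f h.
Proof.
have [q Eg] := petit_of_val g; have [q' Eh] := petit_of_val h.
rewrite {1}Eg {1}Eh addrACA -mulrDl addrC petit_ofDl.
by rewrite -[RHS]petit_valK.
Qed.

(** Left multiples of f form a left ideal, so the right factor may be reduced first. The left factor
    may not in general, and this is how associativity fails. *)
Lemma petit_of_mul_petit_of g h :
  petit_of f (g * petit_val (petit_of f h)) = petit_of f (g * h).
Proof.
have [q Eh] := petit_of_val h.
by rewrite {2}Eh mulrDr addrC mulrA petit_ofDl.
Qed.

Lemma petit_mul_of g h : (skew_size g < skew_size f)%N ->
  petit_mul (petit_of f g) (petit_of f h) = petit_of f (g * h).
Proof. by move=> lt_gf; rewrite /petit_mul petit_of_small // petit_of_mul_petit_of. Qed.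

(** Left multiples of a central f form a two-sided ideal: the left factor can be reduced too, and
    the product is that of a quotient ring. *)
Lemma petit_mulA_central : (forall g, f * g = g * f) -> associative (@petit_mul _ _ f).
Proof.
move=> cf.
have mulE g h : petit_mul (petit_of f g) (petit_of f h) = petit_of f (g * h).
  rewrite /petit_mul petit_of_mul_petit_of; have [q Eg] := petit_of_val g.
  by rewrite {2}Eg mulrDl addrC -mulrA cf mulrA petit_ofDl.
move=> x y z; rewrite -[x]petit_valK -[y]petit_valK -[z]petit_valK.
by rewrite !mulE mulrA.
Qed.

End PetitRing.

(** * Monomials in the rings of t^n - a *)

Section Monomials.
Variables (K : fieldType) (sigma : {rmorphism K -> K}) (n : nat).
Hypothesis n_gt0 : (0 < n)%N.
Implicit Types (a b c d : K) (i j : nat).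

(** The exponent i is unbounded, so that a product of monomials can be written before it is
    reduced. *)
Definition petit_mono a c i : petit (constacyclic_poly sigma n a) :=
  petit_of _ (skewC sigma c * skewX sigma ^+ i).

Let monic_cp a : skew_monic (constacyclic_poly sigma n a) :=
  constacyclic_poly_monic sigma a n_gt0.

Lemma petit_monoC a c : petit_mono a c 0 = petit_of _ (skewC sigma c).
Proof. by rewrite /petit_mono expr0 mulr1. Qed.

Lemma petit_monoX a : petit_mono a 1 1 = petit_of _ (skewX sigma).
Proof. by rewrite /petit_mono skewC1 mul1r expr1. Qed.

Lemma skew_size_mono c i :
  (skew_size (skewC sigma c * skewX sigma ^+ i)%R <= i.+1)%N.
Proof.
rewrite /skew_size skew_monoE (leq_trans (size_scale_leq _ _)) //.
by rewrite size_polyXn.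
Qed.

Lemma petit_monoM a c i d j : (i < n)%N ->
  petit_mul (petit_mono a c i) (petit_mono a d j)
    = petit_mono a (c * iter i sigma d) (i + j).
Proof.
move=> lt_in; rewrite /petit_mono petit_mul_of ?skew_monoM //.
by rewrite constacyclic_poly_size // (leq_ltn_trans (skew_size_mono _ _)).
Qed.

(** Subtract c t^i (t^n - a) and move a to the left of t^i. *)
Lemma petit_mono_red a c i :
  petit_mono a c (n + i) = petit_mono a (c * iter i sigma a) i.
Proof.
rewrite /petit_mono.
have -> : skewC sigma c * skewX sigma ^+ (n + i)
  = skewC sigma (c * iter i sigma a) * skewX sigma ^+ i
    + skewC sigma c * skewX sigma ^+ i * constacyclic_poly sigma n a.
  rewrite /constacyclic_poly mulrBr -mulrA -exprD addnC.
  by rewrite -[X in _ - X]mulrA skewXnC mulrA -skewCM addrC subrK.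
exact: petit_ofDl.
Qed.

(** Strong induction on i: below n the coefficients are compared; otherwise t^n is reduced and the
    nonzero factor sigma^(i-n)(a) cancelled. *)
Lemma petit_mono_inj a i c d : a != 0 ->
  petit_mono a c i = petit_mono a d i -> c = d.
Proof.
move=> nz_a; elim/ltn_ind: i c d => i IHi c d.
have [lt_in|le_ni] := ltnP i n.
  move/(congr1 (@petit_val _ _ _)).
  rewrite /petit_mono !petit_of_small ?constacyclic_poly_size ?ltnS //; first last.
  - exact: leq_trans (skew_size_mono _ _) _.
  - exact: leq_trans (skew_size_mono _ _) _.
  rewrite !skew_monoE => /(congr1 (fun q : {poly K} => q`_i)).
  by rewrite !coefZ coefXn eqxx !mulr1.
rewrite -(subnKC le_ni) !petit_mono_red => /IHi.
rewrite ltn_subrL n_gt0 (leq_trans n_gt0 le_ni) => /(_ isT).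
by apply: mulIf; rewrite iter_sigma_eq0.
Qed.

Lemma petit_associativeP a : (1 < n)%N -> a != 0 ->
  petit_associative sigma n a <-> iter n sigma =1 id /\ sigma a = a.
Proof.
move=> n_gt1 nz_a; split=> [assoc|[sn sa]].
  (* Both bracketings of t^(n-1), t, d t^j: first (t^(n-1) t) = a acts from the left, whereas
     t^(n-1) (t d t^j) = sigma^n(d) t^(n+j). Then j = 0 gives sigma^n = id, and d = 1, j = 1 gives
     sigma(a) = a. *)
  have key d j : petit_mono a (a * d) j =
      petit_mono a (iter n sigma d * iter j sigma a) j.
    have := assoc (petit_mono a 1 n.-1) (petit_mono a 1 1) (petit_mono a d j).
    have lt_n1 : (n.-1 < n)%N by rewrite prednK.
    rewrite [petit_mul (petit_mono _ _ 1) _]petit_monoM //.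
    rewrite [petit_mul _ (petit_mono _ _ 1)]petit_monoM // petit_monoM //.
    rewrite !mul1r iter_sigma1 -iterSr addnA addn1 prednK //.
    rewrite petit_mono_red => ->.
    by rewrite -[n in petit_mono _ 1 n]addn0 petit_mono_red petit_monoM ?mul1r.
  split=> [d|].
    have /petit_mono_inj := key d 0; rewrite /= [a * d]mulrC.
    by move=> /(_ nz_a) /(mulIf nz_a).
  have /petit_mono_inj := key 1 1%N.
  by rewrite mulr1 iter_sigma1 mul1r => /(_ nz_a).
(* Conversely t^n commutes with K because sigma^n = id, and a commutes with t because it is fixed,
   so t^n - a is central. *)
apply: petit_mulA_central; first exact: monic_cp.
have isa i : iter i sigma a = a by elim: i => //= i ->.
move=> g; rewrite [g]skew_poly_sum mulr_sumr mulr_suml.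
apply: eq_bigr => i _; rewrite /constacyclic_poly mulrBl mulrBr; congr (_ - _).
  rewrite -[X in X * _ = _]mul1r -skewC1 -[X in _ = _ * X]mul1r -skewC1.
  by rewrite !skew_monoM iter_sigma1 mul1r mulr1 sn addnC.
by rewrite -[RHS]mulrA skewXnC isa !mulrA -!skewCM [a * _]mulrC.
Qed.

(** * Constraints on an isomorphism with t |-> alpha t^k *)

Section Isomorphism.
Variables (a b alpha : K) (k : nat)
  (G : petit (constacyclic_poly sigma n a) -> petit (constacyclic_poly sigma n b)).
Hypotheses (nz_a : a != 0) (nz_b : b != 0) (nz_alpha : alpha != 0).
Hypothesis GM : {morph G : x y / petit_mul x y}.
Hypothesis GC : forall c, G (petit_mono a c 0) = petit_mono b c 0.
Hypothesis GX : G (petit_mono a 1 1) = petit_mono b alpha k.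
Hypothesis lt_kn : (k < n)%N.

Hypothesis k_gt0 : (0 < k)%N.
Let n_gt1 : (1 < n)%N := leq_ltn_trans k_gt0 lt_kn.

(** Apply G to the relation t c = sigma(c) t. *)
Lemma monomial_iso_iter c : iter k sigma c = sigma c.
Proof.
have : G (petit_mul (petit_mono a 1 1) (petit_mono a c 0))
     = G (petit_mul (petit_mono a (sigma c) 0) (petit_mono a 1 1)).
  by rewrite !petit_monoM //= mul1r mulr1 addn0 add0n.
rewrite !GM !GC !GX !petit_monoM //= addn0 add0n.
by move/(petit_mono_inj nz_b); rewrite [RHS]mulrC => /(mulfI nz_alpha).
Qed.

(** As long as i k < n no reduction occurs in the target; of the coefficient only its being nonzero
    matters later. *)
Lemma monomial_iso_powers i : (i * k < n)%N ->
  exists2 c, c != 0 & G (petit_mono a 1 i) = petit_mono b c (i * k).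
Proof.
elim: i => [|i IHi] lt_in; first by exists 1; rewrite ?oner_neq0 ?GC.
have lt_ikn : (i * k < n)%N.
  by apply: leq_ltn_trans lt_in; rewrite leq_mul2r leqnSn orbT.
have [c nz_c Gc] := IHi lt_ikn.
exists (c * iter (i * k) sigma alpha); first by rewrite mulf_neq0 ?iter_sigma_eq0.
have lt_i : (i < n)%N by rewrite (leq_ltn_trans _ lt_ikn) // leq_pmulr.
have -> : petit_mono a 1 i.+1 = petit_mul (petit_mono a 1 i) (petit_mono a 1 1).
  by rewrite petit_monoM // iter_sigma1 mulr1 addn1.
by rewrite GM Gc GX petit_monoM // mulSnr.
Qed.

(* For v maximal with v k < n, the associators [t^v, t, _] vanish in the source
   because v + 1 < n, whereas in the target t^(v k) t^k wraps around t^n = b. *)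
Lemma monomial_iso_central : (1 < k)%N -> iter n sigma =1 id /\ sigma b = b.
Proof.
move=> k_gt1; pose v := (n.-1 %/ k)%N.
have lt_vk : (v * k < n)%N by rewrite -[X in (_ < X)%N](prednK n_gt0) ltnS leq_divM.
have le_nvk : (n <= v * k + k)%N.
  by rewrite -mulSnr -[X in (X <= _)%N](prednK n_gt0) ltn_ceil.
have v_gt0 : (0 < v)%N by rewrite divn_gt0 // -ltnS prednK.
(* Here k > 1 enters: v + 1 <= 2 v <= v k < n. *)
have lt_v1 : (v.+1 < n)%N.
  rewrite (leq_ltn_trans _ lt_vk) // (leq_trans (_ : _ <= v * 2)%N) //.
    by rewrite muln2 -addnn -addn1 leq_add2l.
  by rewrite leq_mul2l k_gt1 orbT.
have lt_vn : (v < n)%N by apply: ltn_trans lt_v1.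
have [c nz_c Gv] := monomial_iso_powers lt_vk.
(* The overshoot: t^(v k) t^k is a multiple of t^e after one reduction, and e < n lets that monomial
   be a left factor again. *)
pose e := (v * k + k - n)%N.
have Ee : (v * k + k = n + e)%N by rewrite subnKC.
have lt_en : (e < n)%N.
  by rewrite ltn_subLR // (leq_trans (_ : _ < n + k)%N) ?ltn_add2r // leq_add2l ltnW.
(* The vanishing associator [t^v, t, l], transported to the target for any monomial l whose image d
   t^j is known; the common factor c sigma^(v k)(alpha) is cancelled. *)
have key d j d' j' : G (petit_mono a d' j') = petit_mono b d j ->
    iter e sigma b * iter e sigma d
      = iter (n + e) sigma d * iter (e + j) sigma b.
  move=> Gl; set l := petit_mono a d' j' in Gl.
  have asl : petit_mul (petit_mul (petit_mono a 1 v) (petit_mono a 1 1)) l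
     = petit_mul (petit_mono a 1 v) (petit_mul (petit_mono a 1 1) l).
    rewrite [petit_mul (petit_mono _ _ v) (petit_mono _ _ _)]petit_monoM //.
    rewrite addn1 iter_sigma1 mulr1 !petit_monoM // ?ltnW //.
    by rewrite !mul1r -iterSr addnA addn1.
  move/(congr1 G): asl; rewrite !GM Gv GX Gl.
  rewrite [petit_mul (petit_mono b c _) (petit_mono b alpha _)]petit_monoM //.
  rewrite Ee petit_mono_red petit_monoM //.
  rewrite [petit_mul (petit_mono b alpha _) _]petit_monoM // petit_monoM //.
  rewrite addnA Ee -addnA petit_mono_red.
  move/(petit_mono_inj nz_b); rewrite iter_sigmaM mulrA -iterD Ee => E.
  have nz_c' : c * iter (v * k) sigma alpha != 0 by rewrite mulf_neq0 ?iter_sigma_eq0.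
  apply: (mulfI nz_c').
  by rewrite !mulrA in E *.
have iinj i : injective (iter i sigma).
  by elim: i => //= i IHi x y /= /fmorph_inj /IHi.
(* Take l constant, so j = 0 and both sides carry sigma^e(b). *)
have sn : iter n sigma =1 id.
  move=> d; have := key d 0%N d 0%N (GC d).
  rewrite addn0 mulrC => /mulIf E.
  by apply: (iinj e); rewrite -iterD addnC E ?iter_sigma_eq0.
split=> //; apply: (iinj e).
(* Take l = t: then sigma^(e+k)(b) = sigma^e(b), and sigma^k = sigma by [monomial_iso_iter]. *)
have := key alpha k 1 1%N GX; rewrite addnC iterD sn mulrC => /mulfI ->.
  by rewrite iterD monomial_iso_iter.
by rewrite iter_sigma_eq0.
Qed.

(** Apply G to t^n = a and compare with N_n(alpha) t^n = N_n(alpha) b. *)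
Lemma monomial_iso_norm : k = 1%N -> a = b * twisted_norm sigma alpha n.
Proof.
move=> k1.
(* The bound i = n is reached since each step multiplies from the left by t^i with i < n. *)
have Gi i : (i <= n)%N ->
    G (petit_mono a 1 i) = petit_mono b (twisted_norm sigma alpha i) i.
  elim: i => [|i IHi] lt_in; first by rewrite GC twisted_norm0.
  have -> : petit_mono a 1 i.+1 = petit_mul (petit_mono a 1 i) (petit_mono a 1 1).
    by rewrite petit_monoM // iter_sigma1 mulr1 addn1.
  by rewrite GM IHi ?(ltnW lt_in) // GX k1 petit_monoM // addn1 twisted_normS.
have := Gi n (leqnn n); rewrite -[n in petit_mono _ _ n]addn0 petit_mono_red.
rewrite mul1r /= GC -[X in _ = petit_mono _ _ X]addn0 petit_mono_red.
by rewrite [b * _]mulrC => /(petit_mono_inj nz_b).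
Qed.

End Isomorphism.

Lemma monomial_iso_scale a b alpha : alpha != 0 -> a != 0 ->
  a = b * twisted_norm sigma alpha n -> monomial_iso sigma n a b alpha 1.
Proof.
move=> nz_alpha nz_a Ea.
pose fa := constacyclic_poly sigma n a; pose fb := constacyclic_poly sigma n b.
pose G (x : petit fa) : petit fb := petit_of fb (skew_scale alpha (petit_val x)).
pose H (x : petit fb) : petit fa := petit_of fa (skew_scale alpha^-1 (petit_val x)).
have Ef al : skew_scale al (skewX sigma ^+ n) =
    skewC sigma (twisted_norm sigma al n) * skewX sigma ^+ n.
  by rewrite -[X in skew_scale _ X]mul1r -skewC1 skew_scale_mono mulr1.
(* Scaling thus carries left multiples of [fa] to left multiples of [fb], so it commutes with
   reduction. *)
have Ffa : skew_scale alpha fa = skewC sigma (twisted_norm sigma alpha n) * fb.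
  rewrite /fa /constacyclic_poly skew_scaleB Ef skew_scaleC mulrBr -skewCM.
  by rewrite Ea mulrC.
have sa : skew_size fa = n.+1 by exact: constacyclic_poly_size.
have sb : skew_size fb = n.+1 by exact: constacyclic_poly_size.
have ma : skew_monic fa by exact: monic_cp.
have mb : skew_monic fb by exact: monic_cp.
have Gof g : G (petit_of fa g) = petit_of fb (skew_scale alpha g).
  have [q Eg] := petit_of_val ma g.
  by rewrite {2}Eg skew_scaleD skew_scaleM Ffa addrC mulrA petit_ofDl.
(* Scaling never raises the degree, so G and H involve no reduction and are inverse to each other
   because the scalings are. *)
have small (x : petit fa) :
    (skew_size (skew_scale alpha (petit_val x)) < skew_size fb)%N.
  rewrite (leq_ltn_trans (skew_scale_size _ _)) // sb -sa; exact: petit_size.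
have smallV (x : petit fb) :
    (skew_size (skew_scale alpha^-1 (petit_val x)) < skew_size fa)%N.
  rewrite (leq_ltn_trans (skew_scale_size _ _)) // sa -sb; exact: petit_size.
exists G; split=> [|c|].
- split=> [|x y|x y|].
  + exists H => x; apply: val_inj; rewrite /= /G /H.
      by rewrite !petit_of_small // skew_scaleK // petit_size.
    rewrite !petit_of_small //;
    have := @skew_scaleK _ sigma alpha^-1; rewrite invrK => -> //;
      by rewrite ?invr_eq0 ?petit_size.
  + by rewrite /G /= skew_scaleD petit_ofD.
  + rewrite -[in LHS](petit_valK ma x) -[in LHS](petit_valK ma y).
    rewrite petit_mul_of ?petit_size // Gof skew_scaleM.
    by rewrite /G petit_mul_of.
  + by rewrite Gof -skewC1 skew_scaleC.
- by rewrite Gof skew_scaleC.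
- rewrite Gof -[skewX sigma]expr1 -[X in skew_scale _ X]mul1r -skewC1 skew_scale_mono.
  by rewrite mulr1 /twisted_norm big_ord1.
Qed.

Lemma monomial_isoP a b alpha k : monomial_iso sigma n a b alpha k ->
  exists G : petit (constacyclic_poly sigma n a) -> petit (constacyclic_poly sigma n b),
    [/\ bijective G, {morph G : x y / x + y}, {morph G : x y / petit_mul x y},
        forall c, G (petit_mono a c 0) = petit_mono b c 0
      & G (petit_mono a 1 1) = petit_mono b alpha k].
Proof.
case=> G [[bG GD GM _] GC GX]; exists G; split=> // [c|].
  by rewrite !petit_monoC.
by rewrite petit_monoX.
Qed.

Lemma nsigma_equivalentP a b : (1 < n)%N -> a != 0 -> b != 0 ->
  nsigma_equivalent sigma n a b <->
    exists2 alpha, alpha != 0 & a = b * twisted_norm sigma alpha n.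
Proof.
move=> n_gt1 nz_a nz_b; split=> [[alpha [nz /monomial_isoP[G [_ _ GM GC GX]]]]|].
  by exists alpha => //; exact: (monomial_iso_norm nz_b GM GC GX).
by case=> alpha nz Ea; exists alpha; split=> //; apply: monomial_iso_scale.
Qed.

Lemma nsigma_equivalent_isometric a b : (1 < n)%N ->
  nsigma_equivalent sigma n a b -> nsigma_isometric sigma n a b.
Proof. by move=> n_gt1 [alpha [nz iso]]; exists alpha, 1%N. Qed.

(** An exponent k > 1 would force sigma^n = id and sigma(b) = b, making the target associative; only
    k = 1 remains. *)
Lemma nsigma_isometric_nonassoc a b : (1 < n)%N -> a != 0 -> b != 0 ->
  ~ petit_associative sigma n b ->
  nsigma_isometric sigma n a b <-> nsigma_equivalent sigma n a b.
Proof.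
move=> n_gt1 nz_a nz_b nassoc; split; last exact: nsigma_equivalent_isometric.
case=> alpha [k [nz /andP[k_gt0 lt_kn] iso]].
have [G [_ _ GM GC GX]] := monomial_isoP iso.
case: (ltngtP k 1) => [|k_gt1|k1]; first by rewrite ltnNge k_gt0.
  case: nassoc; apply/petit_associativeP => //.
  exact: (monomial_iso_central nz_b nz GM GC GX).
by exists alpha; split; rewrite -?k1.
Qed.

(** The composite sends t to alpha beta t^k. This mixed transitivity makes isometry classes depend
    only on equivalence classes. *)
Lemma nsigma_equivalent_isometric_trans a b c : (1 < n)%N ->
  nsigma_equivalent sigma n a b -> nsigma_isometric sigma n b c ->
  nsigma_isometric sigma n a c.
Proof.
move=> n_gt1 [alpha [nz_alpha iso1]] [beta [k [nz_beta lt_k iso2]]].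
have [G1 [[G1' G1K G1K'] GD1 GM1 GC1 GX1]] := monomial_isoP iso1.
have [G2 [[G2' G2K G2K'] GD2 GM2 GC2 GX2]] := monomial_isoP iso2.
exists (alpha * beta), k; split=> //; first by rewrite mulf_neq0.
exists (G2 \o G1); split=> [|d|].
- split=> [|x y|x y|] /=.
  + by exists (G1' \o G2') => x /=; rewrite ?G2K ?G1K ?G1K' ?G2K'.
  + by rewrite GD1 GD2.
  + by rewrite GM1 GM2.
  + by rewrite /petit_one -!skewC1 -!petit_monoC GC1 GC2.
- by rewrite /= -!petit_monoC GC1 GC2.
- rewrite /= -petit_monoX GX1.
  have -> : petit_mono b alpha 1 = petit_mul (petit_mono b alpha 0) (petit_mono b 1 1).
    by rewrite petit_monoM //= mulr1.
  by rewrite GM2 GC2 GX2 petit_monoM.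
Qed.

End Monomials.

(** * Counting cosets of N-th powers in the units of a finite field *)

Section PowerCosets.
Variables (K : finFieldType) (N : nat).

Definition nonzero_powers : {set K} := [set x ^+ N | x in [set x : K | x != 0]].

(** With u a generator of the cyclic unit group, the N-th powers form the subgroup generated by u^N,
    whose order is #[u] / gcd(#[u], N). *)
Lemma card_nonzero_powers :
  #|nonzero_powers| = (#|K|.-1 %/ gcdn N #|K|.-1)%N.
Proof.
have /cyclicP[u Eu] := field_unit_group_cyclic [set: {unit K}]%G.
have ou : #[u]%g = #|K|.-1 by rewrite orderE -Eu card_finField_unit.
rewrite gcdnC -ou -orderXgcd orderE.
have -> : nonzero_powers = [set FinRing.uval v | v in <[u ^+ N]>%g].
  apply/setP => y; apply/imsetP/imsetP => [[x]|[v /cycleP[i ->] ->]].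
    rewrite inE -unitfE => Ux ->.
    have : FinRing.unit K Ux \in <[u]>%g by rewrite -Eu inE.
    case/cycleP => i Ei; exists (FinRing.unit K Ux ^+ N)%g.
      by rewrite Ei -expgM mulnC expgM mem_cycle.
    by rewrite FinRing.val_unitX.
  exists (val (u ^+ i)%g); first by rewrite inE -unitfE (valP (u ^+ i)%g).
  by rewrite -expgM mulnC expgM FinRing.val_unitX.
by rewrite card_imset //; exact: val_inj.
Qed.

(** D is a union of cosets of the N-th powers and the classes of R are these cosets, all of the same
    size. *)
Lemma card_power_cosets (R : rel K) (D : {set K}) :
  0 \notin D ->
  {in D & nonzero_powers, forall x h, x * h \in D} ->
  {in D &, forall x y,
     R x y <-> exists2 c, c != 0 & x = y * c ^+ N} ->
  (#|equivalence_partition R D| * (#|K|.-1 %/ gcdn N #|K|.-1))%N = #|D|.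
Proof.
move=> D0 DH RP.
have nzD x : x \in D -> x != 0 by move=> xD; apply: contraNneq D0 => <-.
have {}RP x y : x \in D -> y \in D ->
  R x y <-> exists2 c, c != 0 & x = y * c ^+ N by exact: RP.
have powD c x : c != 0 -> x \in D -> x * c ^+ N \in D.
  by move=> nz_c xD; apply: DH => //; apply: imset_f; rewrite inE.
have eqR : {in D & &, equivalence_rel R}.
  move=> x y z xD yD zD; split.
    by apply/RP => //; exists 1; rewrite ?oner_neq0 // expr1n mulr1.
  case/(RP _ _ xD yD) => c nz_c Ex; apply/idP/idP.
    case/(RP _ _ xD zD) => d nz_d E; apply/(RP _ _ yD zD).
    exists (d / c); first by rewrite mulf_neq0 ?invr_eq0.
    by rewrite expr_div_n mulrA -E Ex mulfK ?expf_neq0.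
  case/(RP _ _ yD zD) => d nz_d E; apply/(RP _ _ xD zD).
  by exists (d * c); rewrite ?mulf_neq0 // exprMn mulrA -E.
rewrite -(card_uniform_partition _ (equivalence_partitionP eqR)) // => A.
case/imsetP => x xD ->; rewrite -card_nonzero_powers.
have -> : [set y in D | R x y] = [set x * h | h in nonzero_powers].
  apply/setP => y; rewrite inE; apply/andP/imsetP => [[yD]|[h hH ->]].
    case/(RP _ _ xD yD) => c nz_c E; exists (c^-1 ^+ N).
      by apply: imset_f; rewrite inE invr_eq0.
    by rewrite E exprVn mulfK ?expf_neq0.
  have xhD := DH _ _ xD hH; split=> //; apply/(RP _ _ xD xhD).
  case/imsetP: hH => c; rewrite inE => nz_c ->.
  exists c^-1; first by rewrite invr_eq0.
  by rewrite exprVn mulfK ?expf_neq0.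
by rewrite card_imset //; apply: mulfI; exact: nzD.
Qed.

End PowerCosets.

(** * Powers of Frobenius, their order and fixed field *)

Section FrobeniusPower.
Variables (p r s : nat) (K : finFieldType) (sigma : {rmorphism K -> K}).
Hypotheses (hp : prime p) (hK : #|K| = (p ^ r)%N) (hs : (s %| r)%N).
Hypothesis hsigma : forall x : K, sigma x = x ^+ (p ^ s).
Local Notation q := (p ^ s)%N.
Local Notation m := (r %/ s)%N.

(** If s = 0 then s | r forces r = 0, and K would have one element. *)
Lemma frobenius_exponent_gt0 : (0 < s)%N.
Proof.
have r_gt0 : (0 < r)%N.
  by case: (posnP r) (finNzRing_gt1 K) => // r0; rewrite hK r0.
by case: (posnP s) hs => // ->; rewrite dvd0n; case: (r) r_gt0.
Qed.

Lemma card_base_gt1 : (1 < q)%N.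
Proof.
by have := ltn_exp2r 1 p frobenius_exponent_gt0; rewrite exp1n (prime_gt1 hp).
Qed.

Lemma card_base_pred_gt0 : (0 < q.-1)%N.
Proof. by rewrite -subn1 subn_gt0 card_base_gt1. Qed.

Lemma card_expn_order : (q ^ m = #|K|)%N.
Proof. by rewrite -expnM mulnC divnK. Qed.

Lemma bracketE i : bracket p s i = (\sum_(j < i) q ^ j)%N.
Proof.
by rewrite /bracket expnM !subn1 predn_exp mulKn ?card_base_pred_gt0.
Qed.

Lemma bracketM i : (q.-1 * bracket p s i = (q ^ i).-1)%N.
Proof. by rewrite bracketE -predn_exp. Qed.

Lemma iter_frobenius i x : iter i sigma x = x ^+ (q ^ i).
Proof. by elim: i => [|i IHi] /=; rewrite ?expr1 // hsigma IHi -exprM expnSr. Qed.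

Lemma twisted_norm_bracket alpha n :
  twisted_norm sigma alpha n = alpha ^+ bracket p s n.
Proof.
rewrite bracketE /twisted_norm -prodrXr; apply: eq_bigr => j _.
exact: iter_frobenius.
Qed.

Lemma card_roots_expn (e : nat) (A : {set K}) : (1 < e)%N ->
  {in A, forall x, x ^+ e = x} -> (#|A| <= e)%N.
Proof.
move=> e_gt1 Ae; pose P : {poly K} := 'X^e - 'X.
have sP : size P = e.+1.
  by rewrite size_polyDl ?size_polyXn // size_polyN size_polyX.
rewrite -ltnS -sP cardE; apply: max_poly_roots; last exact: enum_uniq.
  by rewrite -size_poly_eq0 sP.
apply/allP => x; rewrite mem_enum => /Ae xe.
by rewrite /root !hornerE xe subrr.
Qed.

Lemma iter_frobenius_id n : (m %| n)%N <-> iter n sigma =1 id.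
Proof.
have im x : iter m sigma x = x by rewrite iter_frobenius card_expn_order expf_card.
have imk k x : iter (k * m) sigma x = x.
  by elim: k => //= k IHk; rewrite mulSn iterD IHk im.
split=> [/dvdnP[k ->] x|idn]; first exact: imk.
have m_gt0 : (0 < m)%N.
  case: (posnP m) card_expn_order (finNzRing_gt1 K) => // -> <-.
  by rewrite ltnn.
(* The remainder j also satisfies sigma^j = id. If j > 0, all q^m elements of K are roots of X^(q^j)
   - X, contradicting j < m. *)
rewrite /dvdn; have := ltn_pmod n m_gt0; set j := (n %% m)%N => lt_jm.
have idj (x : K) : x ^+ (q ^ j) = x.
  by rewrite -iter_frobenius -[RHS]idn [in RHS](divn_eq n m) addnC iterD imk.
case: (posnP j) => // j_gt0.
have qj_gt1 : (1 < q ^ j)%N by have := ltn_exp2r 1 q j_gt0; rewrite exp1n card_base_gt1.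
have : (q ^ m <= q ^ j)%N.
  by rewrite card_expn_order -cardsT; apply: card_roots_expn => // x _.
by rewrite leq_exp2l ?card_base_gt1 // leqNgt lt_jm.
Qed.

(** Upper bound: fixed elements are roots of X^q - X. Lower bound: the nonzero [m]_s-th powers are
    fixed, and there are (|K| - 1)/[m]_s = q - 1 of them. *)
Lemma card_fixed_field_nonzero : #|[set x in fixed_field sigma | x != 0]| = q.-1.
Proof.
have K1 : #|K|.-1 = (q.-1 * bracket p s m)%N by rewrite bracketM card_expn_order.
have b_gt0 : (0 < bracket p s m)%N.
  have : (0 < #|K|.-1)%N.
    by rewrite -subn1 subn_gt0 finNzRing_gt1.
  by rewrite K1 muln_gt0 => /andP[].
apply/eqP; rewrite eqn_leq; apply/andP; split.
  have F0 : 0 \in fixed_field sigma by rewrite inE rmorph0.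
  have := @card_roots_expn q (fixed_field sigma) card_base_gt1.
  rewrite (cardsD1 0) F0 add1n => H; rewrite -ltnS prednK ?(ltnW card_base_gt1) //.
  apply: leq_trans (H _); last by move=> x; rewrite inE hsigma => /eqP.
  by rewrite ltnS subset_leq_card //; apply/subsetP => x; rewrite !inE andbC.
have := card_nonzero_powers K (bracket p s m).
rewrite (gcdn_idPl _) ?K1 ?dvdn_mull // mulnK // => <-.
apply: subset_leq_card; apply/subsetP => _ /imsetP[x + ->].
rewrite !inE => nz_x; rewrite expf_neq0 // andbT hsigma -exprM.
(* From (q - 1)[m]_s = |K| - 1; with x^|K| = x this gives x^([m]_s q) = x^([m]_s). *)
have -> : (bracket p s m * q = (bracket p s m).-1 + #|K|)%N.
  rewrite mulnC -{1}(prednK (ltnW card_base_gt1)) mulSn -K1 -{1}(prednK b_gt0).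
  by rewrite addSnnS prednK // ltnW ?finNzRing_gt1.
by rewrite exprD expf_card -exprSr prednK.
Qed.

End FrobeniusPower.

(** * Associative and nonassociative parameters and their classes *)

Section ClassCounts.
Variables (p r s n : nat) (K : finFieldType) (sigma : {rmorphism K -> K}).
Hypotheses (hp : prime p) (hK : #|K| = (p ^ r)%N) (hs : (s %| r)%N).
Hypothesis hsigma : forall x : K, sigma x = x ^+ (p ^ s).
Hypothesis n_gt1 : (1 < n)%N.
Local Notation m := (r %/ s)%N.
Local Notation F := (fixed_field sigma).

Lemma petit_associative_fixed a : a != 0 ->
  petit_associative sigma n a <-> (m %| n)%N /\ a \in F.
Proof.
move=> nz_a; rewrite (petit_associativeP sigma (ltnW n_gt1) n_gt1 nz_a) inE.
have idP := iter_frobenius_id hp hK hs hsigma n.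
by split=> -[/idP ? /eqP ?].
Qed.

Lemma mem_assoc_params a :
  (a \in assoc_params sigma n) = [&& a != 0, (m %| n)%N & a \in F].
Proof.
rewrite inE; have [//|nz_a /=] := eqVneq a 0.
apply/asboolP/andP => [/petit_associative_fixed[]|] //.
by move=> ?; apply/petit_associative_fixed.
Qed.

Lemma mem_nonassoc_params a :
  (a \in nonassoc_params sigma n) = (a != 0) && ~~ ((m %| n)%N && (a \in F)).
Proof.
by have := mem_assoc_params a; rewrite !inE; case: eqP => //= _ ->.
Qed.

(** Splitting N_(n+1)(x) at either end gives x sigma(N_n(x)) = N_n(x) sigma^n(x), where sigma^n =
    id. *)
Lemma twisted_norm_fixed : (m %| n)%N ->
  {in nonzero_powers K (bracket p s n), forall h, h \in F}.
Proof.
move=> /(iter_frobenius_id hp hK hs hsigma) idn _ /imsetP[x + ->].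
rewrite !inE -(twisted_norm_bracket hp hK hs hsigma) => nz_x.
have := twisted_normD sigma x 1 n; rewrite addnC twisted_normD idn mulrC.
rewrite /= /(twisted_norm _ _ 1) big_ord1 /= => /(mulfI nz_x) <-.
by [].
Qed.

Lemma card_classes_mul (D : {set K}) : 0 \notin D ->
  {in D & nonzero_powers K (bracket p s n), forall x h, x * h \in D} ->
  (#|equivalence_classes sigma n D|
     * ((p ^ r).-1 %/ gcdn (bracket p s n) (p ^ r).-1))%N = #|D|.
Proof.
move=> D0 DH; rewrite -hK; apply: card_power_cosets => // x y xD yD.
have nzD z : z \in D -> z != 0 by move=> zD; apply: contraNneq D0 => <-.
rewrite asboolE (nsigma_equivalentP sigma (ltnW n_gt1)) ?nzD //.
by split=> -[c nz_c E]; exists c; rewrite // E (twisted_norm_bracket hp hK hs hsigma).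
Qed.

(** Equivalent parameters have the same isometry class, so sending the equivalence class of x to the
    isometry class of x is a well-defined surjection. *)
Lemma card_isometry_assoc :
  (#|isometry_classes sigma n (assoc_params sigma n)|
     <= #|equivalence_classes sigma n (assoc_params sigma n)|)%N.
Proof.
set D := assoc_params sigma n.
pose I x := [set y in D | `[< nsigma_isometric sigma n x y >]].
pose E x := [set y in D | `[< nsigma_equivalent sigma n x y >]].
have nzD z : z \in D -> z != 0 by rewrite mem_assoc_params => /andP[].
have eqvC x y : x \in D -> y \in D ->
    nsigma_equivalent sigma n x y -> nsigma_equivalent sigma n y x.
  move=> xD yD; rewrite !(nsigma_equivalentP sigma (ltnW n_gt1)) ?nzD //.
  move=> -[c nz_c ->].
  exists c^-1; first by rewrite invr_eq0.
  by rewrite twisted_normV mulfK ?twisted_norm_eq0.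
have IE x y : x \in D -> y \in D -> nsigma_equivalent sigma n x y -> I y \subset I x.
  move=> xD yD exy; apply/subsetP => z; rewrite !inE => /andP[-> /asboolP iyz].
  by apply/asboolP; apply: nsigma_equivalent_isometric_trans exy iyz; rewrite // ltnW.
have exx x : x \in D -> x \in E x.
  move=> xD; rewrite inE xD; apply/asboolP.
  apply/(nsigma_equivalentP sigma (ltnW n_gt1)); rewrite ?nzD //.
  exists 1; rewrite ?oner_neq0 // /twisted_norm big1 ?mulr1 // => i _.
  exact: iter_sigma1.
(* Any representative serves; the default is never met, as each class E x contains x. *)
pose h (A : {set K}) := if [pick x in A] is Some x then I x else set0.
have -> : isometry_classes sigma n D = h @: equivalence_classes sigma n D.
  rewrite /isometry_classes /equivalence_classes /equivalence_partition -imset_comp.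
  apply: eq_in_imset => x xD /=; rewrite /h -/(E x) -/(I x).
  case: pickP => [y|/(_ x)]; last by rewrite exx.
  rewrite inE => /andP[yD /asboolP exy]; apply/eqP; rewrite eqEsubset !IE //.
  exact: eqvC.
exact: leq_imset_card.
Qed.

Lemma isometry_classes_nonassoc :
  isometry_classes sigma n (nonassoc_params sigma n)
    = equivalence_classes sigma n (nonassoc_params sigma n).
Proof.
apply: eq_in_imset => x xD; apply/setP => y; rewrite [LHS]in_set [RHS]in_set.
case: (boolP (y \in nonassoc_params sigma n)) => //= yD; apply: asbool_equiv_eq.
move: xD yD (ltnW n_gt1); rewrite !inE => /andP[nz_x _] /andP[nz_y /asboolPn nassoc].
by move=> n_gt0; apply: nsigma_isometric_nonassoc.
Qed.

End ClassCounts.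

(** * Evaluation of the class numbers *)

Theorem theorem5p9 (p r s n : nat) (K : finFieldType)
    (sigma : {rmorphism K -> K})
    (hp : prime p) (hK : #|K| = (p ^ r)%N) (hs : (s %| r)%N)
    (hsigma : forall x : K, sigma x = x ^+ (p ^ s)) (hn : (2 <= n)%N) :
  let m := (r %/ s)%N in
  let d : rat := (gcdn (bracket p s n) (p ^ r - 1))%:R in
  let bm : rat := (bracket p s m)%:R in
  [/\ #|isometry_classes sigma n (nonassoc_params sigma n)|%:R
        = (if (m %| n)%N then (1 - 1 / bm) * d else d),
      forall a : K, a != 0 ->
        (petit_associative sigma n a <->
           (m %| n)%N /\ a \in fixed_field sigma),
      (m %| n)%N ->
        #|equivalence_classes sigma n (assoc_params sigma n)|%:R = d / bm
    & (m %| n)%N ->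
        #|isometry_classes sigma n (assoc_params sigma n)|%:R <= d / bm].
Proof.
move=> m d bm; rewrite /d subn1; set N := bracket p s n; set M := (p ^ r).-1.
have q1_gt0 : (0 < (p ^ s).-1)%N := card_base_pred_gt0 hp hK hs.
have ME : (M = (p ^ s).-1 * bracket p s m)%N.
  by rewrite (bracketM hp hK hs) (card_expn_order hK hs) /M hK.
have M_gt0 : (0 < M)%N by rewrite /M -hK -subn1 subn_gt0 finNzRing_gt1.
have bm_gt0 : (0 < bracket p s m)%N by move: M_gt0; rewrite ME muln_gt0 => /andP[].
have q1_neq0 : (p ^ s).-1%:R != 0 :> rat by rewrite pnatr_eq0 -lt0n.
have bm_neq0 : bm != 0 by rewrite pnatr_eq0 -lt0n.
(* Turns the coset count, for k parameters in c classes, into a rational formula using M = (q -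
   1)[m]_s with q = p^s. *)
have ratE (c k : nat) : (c * (M %/ gcdn N M) = k)%N ->
    c%:R = k%:R * (gcdn N M)%:R / ((p ^ s).-1%:R * bm) :> rat.
  move=> <-; have g_neq0 : (gcdn N M)%:R != 0 :> rat.
    by rewrite pnatr_eq0 -lt0n gcdn_gt0 M_gt0 orbT.
  rewrite -natrM -mulnA divnK ?dvdn_gcdr // [in RHS]ME !natrM mulfK //.
  by rewrite mulf_neq0.
have cardK : #|[set x : K | x != 0]| = M.
  by rewrite /M -hK -(cardsC1 (0 : K)); apply: eq_card => x; rewrite !inE.
have cardF := card_fixed_field_nonzero hp hK hs hsigma.
(* The associative parameters are the q - 1 nonzero elements of the fixed field. *)
have assocE : (m %| n)%N ->
    #|equivalence_classes sigma n (assoc_params sigma n)|%:R = (gcdn N M)%:R / bm.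
  move=> mn; have EA : assoc_params sigma n = [set x in fixed_field sigma | x != 0].
    by apply/setP => a; rewrite (mem_assoc_params hp hK hs hsigma) // mn inE andbC.
  rewrite (ratE _ (p ^ s).-1); first by rewrite -mulf_div divff // mul1r.
  rewrite -cardF EA; apply: (card_classes_mul hp hK hs hsigma hn).
    by rewrite inE eqxx andbF.
  move=> x h; rewrite !inE => /andP[Fx nz_x] hH.
  have := twisted_norm_fixed hp hK hs hsigma mn hH; rewrite inE => /eqP Fh.
  rewrite rmorphM Fh (eqP Fx) eqxx mulf_neq0 //.
  by case/imsetP: hH => c; rewrite inE => nz_c ->; rewrite expf_neq0.
split=> // [|a nz_a|mn]; last 2 first.
- exact: (petit_associative_fixed hp hK hs hsigma hn nz_a).
- rewrite -assocE // ler_nat; exact: card_isometry_assoc hp hK hs hsigma hn.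
rewrite (isometry_classes_nonassoc _ hn).
have memE := mem_nonassoc_params hp hK hs hsigma hn.
(* When m | n each h is a nonzero fixed element, so x h is fixed only if x is. *)
have stable : {in nonassoc_params sigma n & nonzero_powers K N,
    forall x h, x * h \in nonassoc_params sigma n}.
  move=> x h; rewrite !memE => /andP[nz_x NF] hH.
  have nz_h : h != 0 by case/imsetP: hH => c; rewrite inE => nz_c ->; rewrite expf_neq0.
  rewrite mulf_neq0 //=; apply: contra NF => /andP[mn]; rewrite mn /=.
  have := twisted_norm_fixed hp hK hs hsigma mn hH; rewrite !inE => /eqP Fh.
  by rewrite rmorphM Fh => /eqP /(mulIf nz_h) ->.
have notin0 : 0 \notin nonassoc_params sigma n by rewrite memE eqxx.
rewrite (ratE _ _ (card_classes_mul hp hK hs hsigma hn notin0 stable)).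
case: ifP => mn; last first.
  have -> : nonassoc_params sigma n = [set x : K | x != 0].
    by apply/setP => a; rewrite memE mn inE andbT.
  by rewrite cardK ME natrM mulrAC mulfV ?mul1r // mulf_neq0.
(* Now m | n, so exactly the nonzero fixed elements are removed from the units. *)
have -> : #|nonassoc_params sigma n|%:R = M%:R - (p ^ s).-1%:R :> rat.
  rewrite -cardF -cardK -(cardsID (fixed_field sigma) [set x : K | x != 0]).
  rewrite natrD addrAC.
  have -> : [set x : K | x != 0] :&: fixed_field sigma
      = [set x in fixed_field sigma | x != 0].
    by apply/setP => a; rewrite !inE andbC.
  have -> : nonassoc_params sigma n = [set x : K | x != 0] :\: fixed_field sigma.
    by apply/setP => a; rewrite memE mn !inE andbC.
  by rewrite subrr add0r.
rewrite ME natrM -/bm; field.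
by rewrite bm_neq0.
Qed.
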